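(* Assume (A1)–(A6) (listed in the context). Then the equation $$\psi(i)=\inf_{r\in\mathcal{R}}\Bigl[\varphi(i,r)+\sum_{j\neq i}\hat p_{ij}(r)\psi(j)-\rho\,\bar\tau(i,r)\Bigr],\qquad i\in S,$$ in the unknowns $\psi:S\to\mathbb{R}$ and $\rho\in\mathbb{R}$, has a solution $(\psi,\rho)=(h,g)$, where $h$ is a bounded function and $g$ is a scalar.
   Context: Let $S\subseteq\{0,1,2,\dots\}$, with $0\in S$, be the state space, $U$ a compact metric space, $\mathcal{P}(U)$ the set of Borel probability measures on $U$. For $i\ne j$ in $S$ let $\lambda_{ij}:[0,\infty)\times U\to[0,\infty)$ be measurable, and put $\lambda_{ii}(y,u)=-\sum_{j\neq i}\lambda_{ij}(y,u)$. Let $c:S\times\mathbb{R}_+\times U\to\mathbb{R}_+$ be the running cost. Assumptions: (A1) There is a constant $M$ with $\sup_{i\in S,y\ge0,u\in U}\{-\lambda_{ii}(y,u)\}<M$. (A2) $\inf_{i\in S,y\ge0,u\in U}\{-\lambda_{ii}(y,u)\}>m$ for some $m>0$. (A3) For $j\ne i$, $\lambda_{ij}$ is jointly continuous in $(y,u)$, and for each $i$ the sum $\sum_{j\neq i}\lambda_{ij}(y,u)$ converges uniformly (in $(y,u)$). (A4) $c$ is continuous in the second and third variables, and there is a finite constant $\tilde C$ with $\sup_{i,y,u}c(i,y,u)\le\tilde C$. (A5) $S$ is a finite set. (A6) There exists $\delta>0$ such that $\lambda_{i0}(y,u)>\delta$ for all $i\neq0$, $y\ge0$, $u\in U$; and for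 $j\neq0$ (and $i\ne j$), if $\sup_{y,u}\lambda_{ij}(y,u)>0$ then $\inf_{y,u}\lambda_{ij}(y,u)>0$. $\mathcal{R}$ is the set of measurable maps $r:[0,\infty)\to\mathcal{P}(U)$, $y\mapsto r_y=r(y)$. For $i\in S$, $j\neq i$, $r\in\mathcal{R}$: $$\varphi(i,r)=\int_0^\infty\exp\Bigl\{-\int_0^y\int_U\sum_{k\neq i}\lambda_{ik}(s,u)r_s(du)ds\Bigr\}\int_U c(i,y,u)r_y(du)\,dy,$$ $$\hat p_{ij}(r)=\int_0^\infty\exp\Bigl\{-\int_0^y\int_U\sum_{k\neq i}\lambda_{ik}(s,u)r_s(du)ds\Bigr\}\int_U\lambda_{ij}(y,u)r_y(du)\,dy,$$ $$\bar\tau(i,r)=\int_0^\infty\exp\Bigl\{-\int_0^t\int_U\sum_{j\neq i}\lambda_{ij}(y,u)r_y(du)dy\Bigr\}dt.$$ *)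

(* Defs.v *)
From HB Require Import structures.
From mathcomp Require Import all_boot all_order all_algebra.
From mathcomp Require Import all_classical all_reals all_analysis.

Set Implicit Arguments.
Unset Strict Implicit.
Unset Printing Implicit Defensive.

Import Order.TTheory GRing.Theory Num.Theory.
Import numFieldNormedType.Exports.

Local Open Scope classical_set_scope.
Local Open Scope ring_scope.

(* Measurable types have to be pointed, so the action space carries a point;
   this amounts to requiring it to be nonempty. *)
#[short(type="pointedMetricType")]
HB.structure Definition PointedMetric (R : realType) :=
  {M of Metric R M & Pointed M}.

Definition borel (R : realType) (U : pointedMetricType R) :
    measurableType [set A : set U | open A].-sigma :=
  g_sigma_algebraType [set A : set U | open A].

Section SemiMarkovControl.
Context {R : realType} {U : pointedMetricType R}.

(* The states are the elements of [S]; what [lam], [c] and [psi] do at other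
   indices, or [lam] and [c] at negative times, plays no role.  The diagonal
   of [lam] is not used either: [exit_rate S lam i y u] is the number
   - lambda_ii(y,u). *)
Variables (S : set nat) (lam : nat -> nat -> R -> U -> R) (c : nat -> R -> U -> R).

Definition exit_rate (i : nat) (y : R) (u : U) : \bar R :=
  (\esum_(j in S `\ i) (lam i j y u)%:E)%E.

Definition rates_measurable : Prop :=
  forall i j, S i -> S j -> i != j ->
    (forall y u, 0 <= y -> 0 <= lam i j y u) /\
    measurable_fun (`[(0 : R), +oo[ `*` [set: borel U] : set (R * borel U)%type)
      (fun p : R * borel U => lam i j p.1 p.2).

Definition cost_nonneg : Prop :=
  forall i y u, S i -> 0 <= y -> 0 <= c i y u.

Definition exit_rate_values : set (\bar R) :=
  [set z | exists i y u, [/\ S i, 0 <= y & z = exit_rate i y u]].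

Definition rate_values (i j : nat) : set (\bar R) :=
  [set z | exists y u, 0 <= y /\ z = (lam i j y u)%:E].

Definition cost_values : set (\bar R) :=
  [set z | exists i y u, [/\ S i, 0 <= y & z = (c i y u)%:E]].

Definition A1 : Prop := exists M : R, (ereal_sup exit_rate_values < M%:E)%E.

Definition A2 : Prop :=
  exists2 m : R, 0 < m & (m%:E < ereal_inf exit_rate_values)%E.

Definition A3 : Prop :=
  (forall i j, S i -> S j -> i != j ->
    {within `[0, +oo[ `*` [set: U],
      continuous (fun p : R * U => lam i j p.1 p.2)}) /\
  (forall i, S i ->
    {uniform `[0, +oo[ `*` [set: U],
      (fun (n : nat) (p : R * U) =>
         \sum_(0 <= j < n | (j \in S) && (j != i)) lam i j p.1 p.2) @ \oo -->
      (fun p : R * U => fine (exit_rate i p.1 p.2))}).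

(* Only continuity in each of the two variables is asked for. *)
Definition A4 : Prop :=
  (forall i, S i ->
    (forall u, {within `[0, +oo[, continuous (c i ^~ u)}) /\
    (forall y, 0 <= y -> continuous (c i y))) /\
  (exists C : R, (ereal_sup cost_values <= C%:E)%E).

Definition A5 : Prop := finite_set S.

Definition A6 : Prop :=
  (exists2 delta : R, 0 < delta &
    forall i y u, S i -> i != 0%N -> 0 <= y -> delta < lam i 0%N y u) /\
  (forall i j, S i -> S j -> j != 0%N -> i != j ->
    (0 < ereal_sup (rate_values i j))%E -> (0 < ereal_inf (rate_values i j))%E).

(* [pprobability (borel U) R] carries the sigma-algebra generated by the
   evaluations mu |-> mu A; as U is a compact metric space, it is the Borel
   sigma-algebra of the topology of weak convergence. *)
Definition policy : set (R -> pprobability (borel U) R) :=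
  [set r | measurable_fun (`[(0 : R), +oo[ : set R) r].

Implicit Type r : R -> pprobability (borel U) R.

Local Open Scope ereal_scope.

Definition survival (i : nat) r (y : R) : \bar R :=
  expeR (- \int[lebesgue_measure]_(s in `[0%R, y])
             \int[r s]_u exit_rate i s u).

Definition phi (i : nat) r : \bar R :=
  \int[lebesgue_measure]_(y in `[0%R, +oo[)
    (survival i r y * \int[r y]_u (c i y u)%:E).

Definition phat (i j : nat) r : \bar R :=
  \int[lebesgue_measure]_(y in `[0%R, +oo[)
    (survival i r y * \int[r y]_u (lam i j y u)%:E).

Definition taubar (i : nat) r : \bar R :=
  \int[lebesgue_measure]_(t in `[0%R, +oo[) survival i r t.

(* The sum is meant for finite [S]. *)
Definition optimality_equation (psi : nat -> R) (rho : R) : Prop :=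
  forall i, S i ->
    (psi i)%:E = ereal_inf
      [set phi i r + \sum_(j \in S `\ i) (phat i j r * (psi j)%:E)
           - rho%:E * taubar i r | r in policy].

End SemiMarkovControl.

(* Main.v *)
Require Import Defs.
From HB Require Import structures.
From mathcomp Require Import all_boot all_order all_algebra.
From mathcomp Require Import all_classical all_reals all_analysis.
From mathcomp Require Import measurable_realfun ring lra.

Set Implicit Arguments.
Unset Strict Implicit.
Unset Printing Implicit Defensive.

Import Order.TTheory GRing.Theory Num.Theory.
Import numFieldNormedType.Exports.

Local Open Scope classical_set_scope.
Local Open Scope ring_scope.

(** Normalise [h 0 = 0].  For a fixed [rho], the equations at the states
    [i != 0] say that [h] is a fixed point of the operator
<<
      (G_rho h)(i) = inf_r (phi_i + sum_(j != 0, i) phat_ij h_j - rho taubar_i).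
>>
    This operator is monotone and, because every state [i != 0] jumps to [0] at
    rate at least [delta] while the total exit rate is at most [M], it contracts the sup
    norm with the factor [beta = 1 - delta / M] ([sum_phat_off0_le]).  A fixed
    point [H_rho] is the pointwise supremum of the bounded subsolutions
    ([opt_operator_fixpoint]).  A comparison principle
    ([opt_operator_comparison]) bounds a subsolution for [rho] by a
    supersolution for [rho'] up to a multiple of [|rho - rho'|].  Hence
    [F(rho) = (G_rho H_rho)(0)] is Lipschitz.  As
    [0 <= phi <= C taubar], it satisfies [F(0) >= 0 >= F(C)], so that it
    vanishes at some [g] in [[0, C]]; then [(H_g, g)], with [h 0 = 0], solves
    all the equations.

    The bounds on [phi], [phat] and [taubar] rest on the inequality
<<
      int_0^oo exp (- int_0^y L) L(y) dy <= 1
>>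
    for a measurable bounded hazard rate [L >= 0]
    ([integral_survival_hazard_le1]).  Since [L] is merely measurable, it is
    proved without differentiating the primitive of [L]: on a short interval from
    [x] to [y] the integral is at most [exp (M (y - x))] times the decrease of
    the survival function, and these decreases telescope. *)

(** * Abstract average-cost equation with a distinguished state *)

Section average_cost_equation.
Context {R : realType} {I : eqType} {P : Type}.
(** The data of a semi-Markov decision problem: [z] is the distinguished state,
    [s] lists the other states, [r] ranges over the policies, [f i r] and
    [t i r] are the expected cost and duration of a sojourn in [i], and [q i r j]
    is the probability that it ends by a jump to [j].  Jumps to [z] are left
    out of the sums, since the unknown function is to vanish at [z]. *)
Variables (z : I) (s : seq I) (r0 : P).
Variables (f t : I -> P -> R) (q : I -> P -> I -> R) (C B beta : R).

(** The bracket of the optimality equation, for the policy [r]. *)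
Definition opt_value (rho : R) (h : I -> R) (i : I) (r : P) : R :=
  f i r + \sum_(j <- s) q i r j * h j - rho * t i r.

(** The right-hand side of the optimality equation, the set of values being
    bounded below by [opt_value_has_lbound]. *)
Definition opt_operator (rho : R) (h : I -> R) (i : I) : R :=
  inf (range (opt_value rho h i)).

Hypothesis zs : z \notin s.
Hypothesis C0 : 0 <= C.
Hypotheses (beta0 : 0 <= beta) (beta1 : beta < 1).
Hypothesis f_ge0 : forall i r, i \in z :: s -> 0 <= f i r.
Hypothesis f_le : forall i r, i \in z :: s -> f i r <= C * t i r.
Hypothesis t_ge0 : forall i r, i \in z :: s -> 0 <= t i r.
Hypothesis t_le : forall i r, i \in z :: s -> t i r <= B.
Hypothesis q_ge0 : forall i r j, i \in z :: s -> 0 <= q i r j.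
Hypothesis q_le1 : forall i r, i \in z :: s -> \sum_(j <- s) q i r j <= 1.
Hypothesis q_le_beta : forall i r, i \in s -> \sum_(j <- s) q i r j <= beta.

Let B0 : 0 <= B.
Proof. by apply: le_trans (t_ge0 r0 (mem_head z s)) (t_le _ (mem_head z s)). Qed.

Let zsS i : i \in s -> i \in z :: s.
Proof. by rewrite inE => ->; rewrite orbT. Qed.

Let sum_q_le (b : R) (h h' : I -> R) (d : R) i r : i \in z :: s -> 0 <= d ->
  \sum_(j <- s) q i r j <= b -> (forall j, j \in s -> h j <= h' j + d) ->
  \sum_(j <- s) q i r j * h j <= \sum_(j <- s) q i r j * h' j + b * d.
Proof.
move=> iS d0 qb hh'.
apply: (@le_trans _ _ (\sum_(j <- s) (q i r j * h' j + q i r j * d))).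
  rewrite !big_seq; apply: ler_sum => j js.
  by rewrite -mulrDr ler_wpM2l ?q_ge0 ?hh'.
by rewrite big_split /= lerD2l -mulr_suml ler_wpM2r.
Qed.

Lemma opt_value_has_lbound rho h i : i \in z :: s ->
  has_lbound (range (opt_value rho h i)).
Proof.
move=> iS; pose K := \sum_(j <- s) `|h j|.
have K0 : 0 <= K by apply: sumr_ge0.
have hK j : j \in s -> 0 <= h j + K.
  move=> js; rewrite /K (big_rem j js) /=.
  have : 0 <= \sum_(y <- rem j s) `|h y| by apply: sumr_ge0.
  have : - `|h j| <= h j by rewrite lerNl -normrN ler_norm.
  lra.
exists (- K - `|rho| * B) => _ [r _ <-]; rewrite /opt_value.
have := @sum_q_le 1 (fun=> 0) h K i r iS K0 (q_le1 _ iS) hK.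
rewrite big1 => [|j _]; last by rewrite mulr0.
have := f_ge0 r iS.
have : rho * t i r <= `|rho| * B.
  apply: (le_trans (ler_norm _)); rewrite normrM ler_wpM2l//.
  by rewrite ger0_norm ?t_le ?t_ge0.
lra.
Qed.

Lemma opt_operator_le rho h i r : i \in z :: s ->
  opt_operator rho h i <= opt_value rho h i r.
Proof. by move=> iS; apply: ge_inf; [exact: opt_value_has_lbound|exists r]. Qed.

Lemma opt_operator_ge rho h i x : (forall r, x <= opt_value rho h i r) ->
  x <= opt_operator rho h i.
Proof.
by move=> xv; apply: lb_le_inf; [exists (opt_value rho h i r0), r0|move=> _ [r _ <-]].
Qed.

(** Monotonicity, nonexpansiveness (with [b] a bound on the row sums of [q]) and
    Lipschitz dependence on [rho], in one inequality. *)
Lemma opt_operator_perturb (b : R) rho rho' h h' d i : i \in z :: s -> 0 <= d ->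
  (forall r, \sum_(j <- s) q i r j <= b) ->
  (forall j, j \in s -> h j <= h' j + d) ->
  opt_operator rho h i <= opt_operator rho' h' i + b * d + B * `|rho - rho'|.
Proof.
move=> iS d0 qb hh'; rewrite -addrA -lerBlDr; apply: opt_operator_ge => r.
have := opt_operator_le rho h r iS; rewrite /opt_value.
have := sum_q_le iS d0 (qb r) hh'.
have : (rho' - rho) * t i r <= B * `|rho - rho'|.
  apply: (le_trans (ler_norm _)); rewrite normrM distrC mulrC ler_wpM2r//.
  by rewrite ger0_norm ?t_le ?t_ge0.
lra.
Qed.

(** Comparison of a subsolution [u] for [rho] with a supersolution [v] for
    [rho'].  The contraction factor [beta < 1] absorbs the largest excess of [u]
    over [v]. *)
Lemma opt_operator_comparison rho rho' u v i :
  (forall j, j \in s -> u j <= opt_operator rho u j) ->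
  (forall j, j \in s -> opt_operator rho' v j <= v j) ->
  i \in s -> u i <= v i + B * `|rho - rho'| / (1 - beta).
Proof.
move=> uG vG iS; pose d := \big[Num.max/0]_(j <- s) (u j - v j).
have d0 : 0 <= d by rewrite /d bigmax_ge_id.
have uvd j : j \in s -> u j <= v j + d.
  move=> js; rewrite addrC -lerBlDr /d.
  exact: (@le_bigmax_seq _ _ _ s 0 j predT (fun k => u k - v k) js).
have b1 : 0 < 1 - beta by rewrite subr_gt0.
suff dle : d <= B * `|rho - rho'| / (1 - beta).
  by rewrite (le_trans (uvd _ iS))// lerD2l.
have e0 : 0 <= B * `|rho - rho'| by rewrite mulr_ge0.
rewrite ler_pdivlMr// mulrBr mulr1 lerBlDr addrC.
rewrite {1}/d big_seq; apply: bigmax_le => [|j js].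
  by rewrite addr_ge0// mulr_ge0.
have := @opt_operator_perturb beta rho rho' u v d j (zsS js) d0
  (fun r => q_le_beta r js) uvd.
have := uG _ js; have := vG _ js; rewrite [d * _]mulrC; lra.
Qed.

(** The fixed point is the pointwise supremum of the subsolutions with values in
    [[- K, K]]. *)
Lemma opt_operator_fixpoint rho :
  exists h : I -> R, forall i, i \in s -> h i = opt_operator rho h i.
Proof.
have b1 : 0 < 1 - beta by rewrite subr_gt0.
(* K is the solution of K = beta * K + (C + |rho|) * B, so that the operator
   preserves the functions with values in [- K, K]. *)
pose K := (C * B + `|rho| * B) / (1 - beta).
have K0 : 0 <= K by apply: divr_ge0; [rewrite addr_ge0 ?mulr_ge0|exact: ltW].
have KE : K = beta * K + (C * B + `|rho| * B).
  by rewrite /K; field; rewrite gt_eqF.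
have rt i r : i \in s -> - (`|rho| * B) <= rho * t i r <= `|rho| * B.
  move=> iS; rewrite -ler_norml normrM ler_wpM2l// ger0_norm ?t_ge0 ?t_le//;
  exact: zsS.
have CB0 : 0 <= C * B by rewrite mulr_ge0.
have G_ge h i : i \in s -> (forall j, j \in s -> - K <= h j) ->
    - K <= opt_operator rho h i.
  move=> iS hK; apply: opt_operator_ge => r; rewrite /opt_value.
  have := @sum_q_le beta (fun=> 0) h K i r (zsS iS) K0 (q_le_beta _ iS).
  rewrite big1 => [|j _]; last by rewrite mulr0.
  have /[swap]/[apply] : forall j, j \in s -> 0 <= h j + K.
    by move=> j js; rewrite -lerBlDr sub0r hK.
  have := f_ge0 r (zsS iS); have := rt i r iS; lra.
have G_le h i : i \in s -> (forall j, j \in s -> h j <= K) ->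
    opt_operator rho h i <= K.
  move=> iS hK; apply: (le_trans (opt_operator_le _ _ r0 (zsS iS))).
  rewrite /opt_value.
  have := @sum_q_le beta h (fun=> 0) K i r0 (zsS iS) K0 (q_le_beta _ iS).
  rewrite [X in _ <= X + _]big1 => [|j _]; last by rewrite mulr0.
  have /[swap]/[apply] : forall j, j \in s -> h j <= 0 + K.
    by move=> j js; rewrite add0r hK.
  have : f i r0 <= C * B.
    by rewrite (le_trans (f_le _ (zsS iS)))// ler_wpM2l// t_le// zsS.
  have := rt i r0 iS; lra.
have G_mono h h' i : i \in s -> (forall j, j \in s -> h j <= h' j) ->
    opt_operator rho h i <= opt_operator rho h' i.
  move=> iS hh'.
  have := @opt_operator_perturb beta rho rho h h' 0 i (zsS iS) (lexx _)
    (fun r => q_le_beta r iS).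
  rewrite subrr normr0 !mulr0 !addr0; apply => j js.
  by rewrite addr0 hh'.
pose A := [set h : I -> R | (forall j, j \in s -> - K <= h j <= K) /\
  forall i, i \in s -> h i <= opt_operator rho h i].
have A0 : A (fun=> - K).
  split=> [j _|i iS]; first by rewrite lexx/= ge0_cp.
  by apply: G_ge.
pose H i := sup [set h i | h in A].
have ubA i : i \in s -> has_ubound [set h i | h in A].
  by move=> iS; exists K => _ [h [hK _] <-]; case/andP: (hK _ iS).
have AH h i : A h -> i \in s -> h i <= H i.
  by move=> Ah iS; apply: ub_le_sup; [exact: ubA|exists h].
have HK j : j \in s -> - K <= H j <= K.
  move=> js; apply/andP; split; first exact: AH A0 js.
  apply: ge_sup; first by exists (- K), (fun=> - K).
  by move=> _ [h [hK _] <-]; case/andP: (hK _ js).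
have HG i : i \in s -> H i <= opt_operator rho H i.
  move=> iS; apply: ge_sup; first by exists (- K), (fun=> - K).
  move=> _ [h Ah <-]; have [_ hG] := Ah.
  by apply: (le_trans (hG _ iS)); apply: G_mono => // j js; apply: AH.
(* The image of H is again a bounded subsolution, hence is below H. *)
exists H => i iS; apply/eqP; rewrite eq_le HG//=.
apply: (AH (opt_operator rho H)) => //; split=> [j js|j js].
  rewrite G_ge ?G_le//.
    by move=> k ks; case/andP: (HK _ ks).
  by move=> k ks; case/andP: (HK _ ks).
by apply: G_mono.
Qed.

Lemma opt_operatorE rho h i : i \in z :: s ->
  (opt_operator rho h i)%:E =
  ereal_inf (range (fun r => (opt_value rho h i r)%:E)).
Proof.
move=> iS; rewrite -ereal_inf_EFin; last by exists (opt_value rho h i r0), r0.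
  by rewrite image_comp.
exact: opt_value_has_lbound.
Qed.

Lemma average_cost_equation_solvable :
  exists (h : I -> R) (g : R), h z = 0 /\ forall i, i \in z :: s ->
    (h i)%:E = ereal_inf (range (fun r => (opt_value g h i r)%:E)).
Proof.
have b1 : 0 < 1 - beta by rewrite subr_gt0.
have [H HE] := choice opt_operator_fixpoint.
pose F rho := opt_operator rho (H rho) z.
pose L := B / (1 - beta) + B.
have L0 : 0 <= L by rewrite addr_ge0//; apply: divr_ge0 => //; exact: ltW.
(* The increment of H_rho is controlled by the comparison principle. *)
have Flip x y : F x <= F y + L * `|x - y|.
  have := @opt_operator_perturb 1 x y (H x) (H y) (B * `|x - y| / (1 - beta)) z
    (mem_head _ _).
  have -> : 0 <= B * `|x - y| / (1 - beta).
    by apply: divr_ge0; [exact: mulr_ge0|exact: ltW].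
  move=> /(_ isT (fun r => q_le1 r (mem_head _ _))).
  move=> /(_ _)/le_trans; apply.
    by move=> j js; apply: opt_operator_comparison => // k ks; rewrite -HE.
  rewrite /L -/(F y) mul1r -addrA lerD2l.
  by rewrite mulrDl [in leRHS]mulrAC.
have Fcont : {within `[0, C], continuous F}.
  apply: continuous_subspaceT => x; apply/cvgrPdist_le => e e0.
  have L1 : 0 < L + 1 by rewrite ltr_wpDl.
  near=> y.
  have xy : `|x - y| <= e / (L + 1).
    by near: y; apply: cvgr_dist_le => //; exact: divr_gt0.
  apply: (@le_trans _ _ (L * `|x - y|)).
    rewrite ler_norml; have := Flip x y; have := Flip y x.
    rewrite distrC; lra.
  apply: (@le_trans _ _ ((L + 1) * `|x - y|)).
    by rewrite ler_wpM2r// lerDl.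
  by rewrite mulrC -ler_pdivlMr.
(* For rho = 0, the null function is a subsolution. *)
have F0 : 0 <= F 0.
  apply: opt_operator_ge => r; rewrite /opt_value mul0r subr0.
  rewrite addr_ge0 ?f_ge0 ?mem_head// big_seq sumr_ge0// => j js.
  rewrite mulr_ge0 ?q_ge0 ?mem_head//.
  have := @opt_operator_comparison 0 0 (fun=> 0) (H 0) j.
  rewrite subrr normr0 mulr0 mul0r addr0; apply => // k ks; last by rewrite -HE.
  apply: opt_operator_ge => r'; rewrite /opt_value mul0r subr0.
  by rewrite big1 ?addr0 ?f_ge0 ?zsS// => ? _; rewrite mulr0.
(* For rho = C, the null function is a supersolution, as f <= C * t. *)
have FC : F C <= 0.
  have Hle0 j : j \in s -> H C j <= 0.
    have := @opt_operator_comparison C C (H C) (fun=> 0) j.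
    rewrite subrr normr0 mulr0 mul0r addr0; apply => // k ks; first by rewrite -HE.
    apply: (le_trans (opt_operator_le _ _ r0 (zsS ks))); rewrite /opt_value.
    by rewrite big1 ?addr0 ?subr_le0 ?f_le ?zsS// => ? _; rewrite mulr0.
  apply: (le_trans (opt_operator_le _ _ r0 (mem_head _ _))); rewrite /opt_value.
  have := f_le r0 (mem_head z s).
  suff : \sum_(j <- s) q z r0 j * H C j <= 0 by lra.
  rewrite big_seq; apply: sumr_le0 => j js.
  by rewrite mulr_ge0_le0 ?q_ge0 ?mem_head ?Hle0.
have [g _ Fg] : exists2 g, g \in `[0, C] & F g = 0.
  by apply: IVT => //; rewrite ge_min le_max FC F0 orbT.
have nz j : j \in s -> (j == z) = false.
  by move=> js; apply: contraNF zs => /eqP <-.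
pose h i := if i == z then 0 else H g i.
have hE i : opt_operator g h i = opt_operator g (H g) i.
  suff E : opt_value g h i = opt_value g (H g) i by rewrite /opt_operator E.
  apply/funext => r; rewrite /opt_value.
  by congr (_ + _ - _); apply: eq_big_seq => j js; rewrite /h nz.
exists h, g; split=> [|i]; first by rewrite /h eqxx.
move=> iS; rewrite -opt_operatorE//; congr EFin; move: iS.
rewrite inE hE /h; case: eqVneq => [-> _|_ /= iS]; first exact/esym.
by rewrite -HE.
Unshelve. all: by end_near.
Qed.

End average_cost_equation.

(** * Exponential survival functions of measurable hazard rates *)

Section ge0_le_integral_nonmeasurable.
Local Open Scope ereal_scope.
Import HBNNSimple.

(** The integral of a nonnegative function is a supremum over the simple
    functions below it, so it is monotone without any measurability. *)
Lemma ge0_le_integral_nonmeasurable d (T : measurableType d) (R : realType)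
    (mu : {measure set T -> \bar R}) (D : set T) (f1 f2 : T -> \bar R) :
  (forall x, D x -> 0 <= f1 x) -> (forall x, D x -> f1 x <= f2 x) ->
  \int[mu]_(x in D) f1 x <= \int[mu]_(x in D) f2 x.
Proof.
move=> f10 f12; rewrite !(integral_mkcond D).
have h1 x : 0 <= (f1 \_ D) x by apply: erestrict_ge0.
have h12 x : (f1 \_ D) x <= (f2 \_ D) x by apply: lee_restrict.
rewrite !ge0_integralTE//; last by move=> x; exact: le_trans (h12 x).
apply: ge_ereal_sup => _ [h hf <-].
by apply: ereal_sup_ubound; exists h => // x; exact: le_trans (h12 x).
Qed.

End ge0_le_integral_nonmeasurable.

Section survival_function.
Context {R : realType}.
Local Open Scope ereal_scope.
Notation mu := (@lebesgue_measure R).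
Variables (L : R -> R) (M : R).
Hypothesis mL : measurable_fun (`[0%R, +oo[ : set R) L.
Hypothesis L_ge0 : forall y, (0 <= y)%R -> (0 <= L y)%R.
Hypothesis L_le : forall y, (0 <= y)%R -> (L y <= M)%R.

(** The primitive [y |-> int_0^y L] of the hazard rate [L]; it is [0] for
    [y < 0], where the interval is empty. *)
Definition cumulative_hazard (y : R) : R :=
  fine (\int[mu]_(s in `[0%R, y]) (L s)%:E).

(** The probability of survival up to time [y] under the hazard rate [L]. *)
Definition survival_of_hazard (y : R) : R := expR (- cumulative_hazard y).

Let sub_ray (a b : bool) (x y : R) : (0 <= x)%R ->
  [set` Interval (BSide a x) (BSide b y)] `<=` (`[0%R, +oo[ : set R).
Proof.
move=> x0 s /=; rewrite !in_itv/= andbT => /andP[xs _].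
apply: (le_trans x0); exact: lteifW xs.
Qed.

Let mLE (a b : bool) (x y : R) : (0 <= x)%R ->
  measurable_fun ([set` Interval (BSide a x) (BSide b y)] : set R)
    (fun s => (L s)%:E).
Proof.
move=> x0; apply/measurable_EFinP.
by apply: measurable_funS mL => //; exact: sub_ray.
Qed.

Let int_L_ge0 (a b : bool) (x y : R) : (0 <= x)%R ->
  0 <= \int[mu]_(s in [set` Interval (BSide a x) (BSide b y)]) (L s)%:E.
Proof.
move=> x0; apply: integral_ge0 => s /(sub_ray x0) /=.
by rewrite in_itv/= andbT lee_fin => /L_ge0.
Qed.

Let int_L_le (a b : bool) (x y : R) : (0 <= x <= y)%R ->
  \int[mu]_(s in [set` Interval (BSide a x) (BSide b y)]) (L s)%:E
    <= (M * (y - x))%:E.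
Proof.
move=> /andP[x0 xy].
apply: (@le_trans _ _
    (\int[mu]_(s in [set` Interval (BSide a x) (BSide b y)]) (cst M%:E s))).
  apply: ge0_le_integral_nonmeasurable => s /(sub_ray x0) /=;
    rewrite in_itv/= andbT lee_fin; [exact: L_ge0|exact: L_le].
rewrite integral_cst//= lebesgue_measure_itv/= lte_fin.
case: ltP => [_|yx]; first by rewrite -EFinB -EFinM.
by rewrite mule0 lee_fin (le_anti (introT andP (conj xy yx))) subrr mulr0.
Qed.

Lemma cumulative_hazardE y :
  \int[mu]_(s in `[0%R, y]) (L s)%:E = (cumulative_hazard y)%:E.
Proof.
rewrite fineK//; have [y0|y0] := leP 0%R y; last first.
  by rewrite set_itv_ge ?integral_set0// bnd_simp -ltNge.
rewrite ge0_fin_numE ?int_L_ge0//.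
by apply: (le_lt_trans (int_L_le _ _ _)); rewrite ?ltry// lexx.
Qed.

Lemma cumulative_hazardD x y : (0 <= x <= y)%R ->
  \int[mu]_(s in `]x, y]) (L s)%:E =
  (cumulative_hazard y - cumulative_hazard x)%:E.
Proof.
move=> /andP[x0 xy].
have split_itv : `[0%R, y]%classic = `[0%R, x]%classic `|` `]x, y]%classic :> set R.
  by rewrite -itv_bndbnd_setU ?bnd_simp.
have := cumulative_hazardE y.
rewrite split_itv ge0_integral_setU//; first last.
- apply/disj_setPLR => s /=; rewrite !in_itv/= => /andP[_ sx].
  by apply/negP; rewrite negb_and -leNgt sx.
- move=> s; rewrite -split_itv => /(sub_ray (lexx _)) /=.
  by rewrite in_itv/= andbT lee_fin => /L_ge0.
- by rewrite -split_itv; exact: mLE.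
rewrite cumulative_hazardE.
case: (\int[mu]_(s in `]x, y]) _) => //= a.
by rewrite -EFinD => -[<-]; congr EFin; ring.
Qed.

Lemma cumulative_hazard_ge0 y : (0 <= cumulative_hazard y)%R.
Proof. by rewrite fine_ge0// int_L_ge0. Qed.

Lemma cumulative_hazard_homo : {homo cumulative_hazard : x y / (x <= y)%R}.
Proof.
move=> x y xy; have [x0|x0] := leP 0%R x.
  rewrite -subr_ge0 -lee_fin -cumulative_hazardD ?int_L_ge0//.
  by rewrite x0.
rewrite [leLHS](_ : _ = 0%R) ?cumulative_hazard_ge0//.
by rewrite /cumulative_hazard set_itv_ge ?integral_set0// bnd_simp -ltNge.
Qed.

Lemma survival_of_hazard_ge0 y : (0 <= survival_of_hazard y)%R.
Proof. exact: expR_ge0. Qed.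

Lemma survival_of_hazard_measurable (D : set R) : measurable D ->
  measurable_fun D survival_of_hazard.
Proof.
move=> mD; apply: nonincreasing_measurable; first exact: mD.
move=> x y xy.
by rewrite ler_expR lerN2 cumulative_hazard_homo.
Qed.

(** The density of the time of death. *)
Let density (s : R) : \bar R := (survival_of_hazard s * L s)%:E.

Let density_ge0 s : (0 <= s)%R -> 0 <= density s.
Proof. by move=> s0; rewrite lee_fin mulr_ge0 ?survival_of_hazard_ge0 ?L_ge0. Qed.

Let mdensity (a b : bool) (x y : R) : (0 <= x)%R ->
  measurable_fun ([set` Interval (BSide a x) (BSide b y)] : set R) density.
Proof.
move=> x0; apply/measurable_EFinP/measurable_funM.
  exact: survival_of_hazard_measurable.
by apply: measurable_funS mL => //; exact: sub_ray.
Qed.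

(** The factor [expR (M * (y - x))] tends to [1] as the interval shrinks, which
    replaces the exact identity with factor [1]. *)
Let integral_density_le x y : (0 <= x <= y)%R ->
  \int[mu]_(s in `]x, y]) density s <=
  (expR (M * (y - x)) * (survival_of_hazard x - survival_of_hazard y))%:E.
Proof.
move=> /andP[x0 xy]; set a := cumulative_hazard.
have axy : (a y - a x <= M * (y - x))%R.
  by rewrite -lee_fin -cumulative_hazardD ?x0// int_L_le ?x0.
apply: (@le_trans _ _ (\int[mu]_(s in `]x, y]) ((survival_of_hazard x)%:E * (L s)%:E))).
  apply: ge0_le_integral_nonmeasurable => s sxy.
    have := sub_ray x0 sxy; rewrite /= in_itv/= andbT; exact: density_ge0.
  have := sub_ray x0 sxy; rewrite /= in_itv/= andbT => s0.
  move: sxy; rewrite /= in_itv/= => /andP[xs _].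
  rewrite -EFinM lee_fin; apply: ler_wpM2r; first exact: L_ge0.
  rewrite ler_expR lerN2; exact/cumulative_hazard_homo/ltW.
rewrite ge0_integralZl_EFin ?survival_of_hazard_ge0//; first last.
- exact: mLE.
- move=> s /(sub_ray x0) /=; rewrite in_itv/= andbT lee_fin; exact: L_ge0.
rewrite cumulative_hazardD ?x0// -EFinM lee_fin /survival_of_hazard -/a.
have d0 : (0 <= a y - a x)%R by rewrite subr_ge0 cumulative_hazard_homo.
(* With d the hazard accumulated on ]x, y], the claim follows from
   d * exp (- d) <= 1 - exp (- d) and exp d <= exp (M * (y - x)). *)
have -> : (- a y = - a x - (a y - a x))%R by ring.
set d := (a y - a x)%R in axy d0 *.
rewrite expRD [(expR (M * _) * _)%R]mulrC -[X in (X - _ * _)%R]mulr1 -mulrBr -mulrA.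
rewrite ler_wpM2l ?expR_ge0//.
have e1 : (expR d * expR (- d) = 1)%R by rewrite -expRD subrr expR0.
have e2 : (1 + d <= expR d)%R := expR_ge1Dx d.
have e3 : (expR (- d) <= 1)%R by rewrite expR_le1 oppr_le0.
have e4 : (expR d <= expR (M * (y - x)))%R by rewrite ler_expR.
apply: (@le_trans _ _ ((1 - expR (- d)) * expR d)%R).
  by rewrite mulrBl mul1r [(expR (- d) * _)%R]mulrC e1; lra.
by rewrite ler_wpM2l// subr_ge0.
Qed.

Let integral_densityD x y : (0 <= x <= y)%R ->
  \int[mu]_(s in `[0%R, y]) density s =
  \int[mu]_(s in `[0%R, x]) density s + \int[mu]_(s in `]x, y]) density s.
Proof.
move=> /andP[x0 xy].
have split_itv : `[0%R, y]%classic = `[0%R, x]%classic `|` `]x, y]%classic :> set R.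
  by rewrite -itv_bndbnd_setU ?bnd_simp.
rewrite split_itv; apply: ge0_integral_setU; first exact: measurable_itv.
- exact: measurable_itv.
- by rewrite -split_itv; exact: mdensity (lexx _).
- move=> s; rewrite -split_itv => /(sub_ray (lexx _)) /=.
  by rewrite in_itv/= andbT => /density_ge0.
- apply/disj_setPLR => s /=; rewrite !in_itv/= => /andP[_ sx].
  by apply/negP; rewrite negb_and -leNgt sx.
Qed.

Let integral_density_grid (e : R) (n : nat) : (0 <= e)%R ->
  \int[mu]_(s in `[0%R, (n%:R * e)%R]) density s <=
  (expR (M * e) * (1 - survival_of_hazard (n%:R * e)))%:E.
Proof.
move=> e0; elim: n => [|n IH].
  rewrite mul0r set_itv1 integral_set1 lee_fin mulr_ge0 ?expR_ge0// subr_ge0.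
  by rewrite expR_le1 oppr_le0 cumulative_hazard_ge0.
have x0 : (0 <= n%:R * e)%R by rewrite mulr_ge0.
have xy : (n%:R * e <= n.+1%:R * e)%R by rewrite ler_wpM2r// ler_nat.
have ye : (n.+1%:R * e = n%:R * e + e)%R by rewrite -natr1; ring.
move: (n%:R * e)%R (n.+1%:R * e)%R x0 xy ye IH => x y x0 xy ye IH.
rewrite (@integral_densityD x y); last by rewrite x0 xy.
apply: (le_trans (leeD IH (integral_density_le _))); first by rewrite x0.
have -> : (y - x = e)%R by rewrite ye; ring.
rewrite -EFinD lee_fin -mulrDr; apply: ler_wpM2l; first exact: expR_ge0.
by rewrite addrA subrK.
Qed.

(** Total mass at most [1]; the defect is the probability of never dying. *)
Lemma integral_survival_hazard_le1 :
  \int[mu]_(s in `[0%R, +oo[) (survival_of_hazard s * L s)%:E <= 1.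
Proof.
have M0 : (0 <= M)%R by exact: le_trans (L_ge0 (lexx _)) (L_le (lexx _)).
have segment n : \int[mu]_(s in `[0%R, n.+1%:R]) density s <= 1.
  apply/lee_addgt0Pr => e e0.
  have l0 : (0 < ln (1 + e))%R by rewrite ln_gt0// ltrDl.
  (* [0, n + 1] is cut into k + 1 pieces so short that exp (M * length) is at
     most 1 + e. *)
  pose k := Num.truncn (M * n.+1%:R / ln (1 + e)).
  have kle : (M * (n.+1%:R / k.+1%:R) <= ln (1 + e))%R.
    rewrite mulrA ler_pdivrMr// [leRHS]mulrC -ler_pdivrMr//.
    exact/ltW/truncnS_gt.
  have := @integral_density_grid (n.+1%:R / k.+1%:R) k.+1
    (divr_ge0 (ler0n _ _) (ler0n _ _)).
  rewrite [(k.+1%:R * _)%R]mulrC divfK ?pnatr_eq0// => /le_trans; apply.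
  rewrite -EFinD lee_fin.
  apply: (@le_trans _ _ ((1 + e) * 1)%R); last by rewrite mulr1.
  apply: ler_pM; rewrite ?expR_ge0//.
  - by rewrite subr_ge0 expR_le1 oppr_le0 cumulative_hazard_ge0.
  - by rewrite -[leRHS]lnK ?ler_expR// posrE addr_gt0.
  - by rewrite gerBl survival_of_hazard_ge0.
rewrite itv0y_bigcup0S.
have cv : \int[mu]_(s in `[0%R, n.+1%:R]) density s @[n --> \oo] -->
    \int[mu]_(s in \bigcup_n `[0%R, n.+1%:R]%classic) density s.
  apply: ge0_nondecreasing_set_cvg_integral => //.
  - move=> m n mn; apply/subsetPset => s /=; rewrite !in_itv/= => /andP[-> /= sm].
    by rewrite (le_trans sm)// ler_nat.
  - by move=> n; exact: mdensity.
  - by move=> n s /(sub_ray (lexx _))/=; rewrite in_itv/= andbT => /density_ge0.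
rewrite -(cvg_lim _ cv)//; apply: lime_le; first exact: cvgP cv.
exact: nearW.
Qed.

End survival_function.

(** * Sojourn in a state under a policy *)

Section state_bounds.
Context {R : realType} {U : pointedMetricType R}.
Variables (S : set nat) (lam : nat -> nat -> R -> U -> R) (c : nat -> R -> U -> R).
Variables (i : nat) (r : R -> pprobability (borel U) R) (m M : R).
Hypothesis finS : finite_set S.
Hypothesis mlam : rates_measurable S lam.
Hypothesis Si : S i.
Hypothesis mr : policy r.
Hypothesis m0 : 0 < m.
Hypothesis exit_rate_ge : forall y u, 0 <= y -> (m%:E <= exit_rate S lam i y u)%E.
Hypothesis exit_rate_le : forall y u, 0 <= y -> (exit_rate S lam i y u <= M%:E)%E.
Notation mu := (@lebesgue_measure R).

Let finSi : finite_set (S `\ i). Proof. exact: finite_setD. Qed.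

(** Times are clipped at [0], so that the rates and the policy, which are
    constrained at nonnegative times only, give functions measurable on all of
    [R]. *)
Definition clip (s : R) : R := Num.max 0 s.

Let clip_ge0 s : 0 <= clip s. Proof. by rewrite /clip le_max lexx. Qed.

Let clip_id s : 0 <= s -> clip s = s.
Proof. by move=> s0; rewrite /clip max_r. Qed.

Let clip_measurable : measurable_fun [set: R] clip.
Proof. exact: measurable_maxr. Qed.

(** The rates out of [i], extended by clipping the time and by [0] at the indices
    [j] that are not targets of a jump. *)
Definition clipped_rate (j : nat) (p : R * borel U) : R :=
  if j \in S `\ i then lam i j (clip p.1) p.2 else 0.

Lemma clipped_rate_ge0 j p : 0 <= clipped_rate j p.
Proof.
rewrite /clipped_rate; case: ifPn => // /[!inE] -[Sj /eqP ji].
by have [+ _] := mlam Si Sj (contra_neq esym ji); apply; exact: clip_ge0.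
Qed.

Lemma clipped_rate_measurable j :
  measurable_fun [set: R * borel U] (clipped_rate j).
Proof.
rewrite /clipped_rate; have [/[!inE] -[Sj /eqP ji]|_] := boolP (j \in S `\ i).
  have [_ mf] := mlam Si Sj (contra_neq esym ji).
  apply: (@measurable_comp _ _ _ _ _ _ (`[(0 : R), +oo[ `*` [set: borel U])
    (fun p : R * borel U => lam i j p.1 p.2) setT
    (fun p : R * borel U => (clip p.1, p.2))) => //.
  - exact: measurableX.
  - by move=> _ [p _ <-] /=; split=> //; rewrite /= in_itv/= andbT clip_ge0.
  - apply: measurable_fun_pair => //=.
    exact: (measurableT_comp clip_measurable).
exact: measurable_cst.
Qed.

Lemma exit_rate_clipped s u :
  exit_rate S lam i (clip s) u =
  (\sum_(j \in S `\ i) (clipped_rate j (s, u))%:E)%E.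
Proof.
have E j : j \in S `\ i -> lam i j (clip s) u = clipped_rate j (s, u).
  by rewrite /clipped_rate => ->.
rewrite /exit_rate esum_fset//; last first.
  by move=> j jS; rewrite E// lee_fin clipped_rate_ge0.
by apply: eq_fsbigr => j jS; rewrite E.
Qed.

Let M0 : 0 <= M.
Proof.
rewrite -lee_fin; apply: le_trans (exit_rate_le point (lexx 0)).
by apply: le_trans (exit_rate_ge point (lexx 0)); rewrite lee_fin ltW.
Qed.

Lemma clipped_rate_le j p : clipped_rate j p <= M.
Proof.
have [jS|jS] := boolP (j \in S `\ i); last by rewrite /clipped_rate (negbTE jS).
case: p => s u; rewrite -lee_fin; apply: le_trans (exit_rate_le u (clip_ge0 s)).
rewrite exit_rate_clipped (fsbigD1 j)//=; last by rewrite inE in jS.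
by rewrite leeDl// fsume_ge0// => k _; rewrite lee_fin clipped_rate_ge0.
Qed.

(** The rate from [i] to [j] averaged over the actions drawn by the policy. *)
Definition mean_rate (j : nat) (s : R) : R :=
  fine (\int[r (clip s)]_u (clipped_rate j (s, u))%:E).

Let int_rate_ge0 j s :
  (0 <= \int[r (clip s)]_u (clipped_rate j (s, u))%:E)%E.
Proof. by apply: integral_ge0 => u _; rewrite lee_fin clipped_rate_ge0. Qed.

Let int_prob_cst s (a : R) : (\int[r s]_u (cst a%:E u) = a%:E)%E.
Proof. by rewrite integral_cst// [X in (_ * X)%E]probability_setT mule1. Qed.

Lemma mean_rateE j s :
  (\int[r (clip s)]_u (clipped_rate j (s, u))%:E = (mean_rate j s)%:E)%E.
Proof.
rewrite /mean_rate fineK// ge0_fin_numE//.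
apply: (@le_lt_trans _ _ (\int[r (clip s)]_u (cst M%:E u))%E).
  apply: ge0_le_integral_nonmeasurable => u _.
    by rewrite lee_fin clipped_rate_ge0.
  by rewrite lee_fin clipped_rate_le.
by rewrite int_prob_cst ltry.
Qed.

Lemma mean_rate_ge0 j s : 0 <= mean_rate j s.
Proof. by rewrite fine_ge0. Qed.

(** As [r] is measurable, it is a probability kernel, and integrals with respect
    to a kernel are measurable in the parameter. *)
Lemma mean_rate_measurable j : measurable_fun [set: R] (mean_rate j).
Proof.
have mr' : measurable_fun [set: R] (r \o clip).
  apply: (measurable_comp _ _ mr clip_measurable) => //.
  by move=> _ [s _ <-] /=; rewrite in_itv/= andbT clip_ge0.
apply: (measurableT_comp (fine_measurable _)) => //.
apply: (@measurable_fun_integral_finite_kernel _ _ _ _ _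
  (fun p : R * borel U => (clipped_rate j p)%:E) (kprobability mr')).
- by move=> p; rewrite lee_fin clipped_rate_ge0.
- apply/measurable_EFinP; exact: clipped_rate_measurable.
Qed.

(** The total averaged exit rate from [i]. *)
Definition hazard (s : R) : R := \sum_(j \in S `\ i) mean_rate j s.

Lemma hazardE s :
  (\int[r (clip s)]_u exit_rate S lam i (clip s) u = (hazard s)%:E)%E.
Proof.
under eq_integral do rewrite exit_rate_clipped.
rewrite ge0_integral_fsum//; first last.
- by move=> j u _; rewrite lee_fin clipped_rate_ge0.
- move=> j; apply/measurable_EFinP.
  exact: (measurable_fun_pair2 _ (clipped_rate_measurable j)).
by under eq_fsbigr do rewrite mean_rateE; rewrite fsumEFin.
Qed.

Lemma hazard_ge s : m <= hazard s.
Proof.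
rewrite -lee_fin -hazardE -[leLHS](int_prob_cst (clip s)).
apply: ge0_le_integral_nonmeasurable => u _; first by rewrite lee_fin ltW.
exact/exit_rate_ge/clip_ge0.
Qed.

Lemma hazard_le s : hazard s <= M.
Proof.
rewrite -lee_fin -hazardE -[leRHS](int_prob_cst (clip s)).
apply: ge0_le_integral_nonmeasurable => u _.
  by apply: le_trans (exit_rate_ge _ (clip_ge0 s)); rewrite lee_fin ltW.
exact/exit_rate_le/clip_ge0.
Qed.

Let hazard_ge0 s : 0 <= hazard s.
Proof. exact: le_trans (ltW m0) (hazard_ge s). Qed.

Lemma hazard_measurable : measurable_fun [set: R] hazard.
Proof.
rewrite /hazard; under eq_fun do rewrite fsbig_finite//=.
by apply: measurable_sum => j; exact: mean_rate_measurable.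
Qed.

Let mhazard : measurable_fun (`[0, +oo[ : set R) hazard.
Proof. by apply: measurable_funTS; exact: hazard_measurable. Qed.

Let surv := survival_of_hazard hazard.

Lemma survivalE y : survival S lam i r y = (surv y)%:E.
Proof.
rewrite /survival (_ : (\int[_]_(s in _) _ = (cumulative_hazard hazard y)%:E)%E)//.
rewrite -(@cumulative_hazardE _ hazard M); last 2 first.
- by move=> s _; exact: hazard_ge0.
- by move=> s _; exact: hazard_le.
apply: eq_integral => s; rewrite inE/= in_itv/= => /andP[s0 _].
by rewrite -hazardE clip_id.
Qed.

Let phatE j : j \in S `\ i ->
  phat S lam i j r = (\int[mu]_(y in `[0%R, +oo[) (surv y * mean_rate j y)%:E)%E.
Proof.
move=> jS; apply: eq_integral => y; rewrite inE/= in_itv/= andbT => y0.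
rewrite survivalE EFinM -mean_rateE clip_id//; congr (_ * _)%E.
by apply: eq_integral => u _; rewrite /clipped_rate jS clip_id.
Qed.

Let surv_ge0 y : 0 <= surv y. Proof. exact: survival_of_hazard_ge0. Qed.

Let surv_measurable : measurable_fun (`[(0:R), +oo[ : set R) surv.
Proof.
exact: (survival_of_hazard_measurable mhazard (fun s _ => hazard_ge0 s)
  (fun s _ => hazard_le s)).
Qed.

Let integral_surv_hazard :
  (\int[mu]_(y in `[0%R, +oo[) (surv y * hazard y)%:E <= 1)%E.
Proof.
exact: (integral_survival_hazard_le1 mhazard (fun s _ => hazard_ge0 s)
  (fun s _ => hazard_le s)).
Qed.

Let integral_surv_le (f : R -> R) (b : R) : 0 <= b ->
  (forall y, 0 <= y -> 0 <= f y <= b * hazard y) ->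
  (\int[mu]_(y in `[0%R, +oo[) (surv y * f y)%:E <= b%:E)%E.
Proof.
move=> b0 fb.
apply: (@le_trans _ _
    (\int[mu]_(y in `[0%R, +oo[) (b%:E * (surv y * hazard y)%:E))%E).
  apply: ge0_le_integral_nonmeasurable => y /=; rewrite in_itv/= andbT => y0;
    have /andP[f0 fbh] := fb y y0; first by rewrite lee_fin mulr_ge0.
  by rewrite -EFinM lee_fin mulrCA ler_wpM2l.
rewrite ge0_integralZl_EFin//; last 2 first.
- by move=> y _; rewrite lee_fin mulr_ge0.
- apply/measurable_EFinP/measurable_funM => //.
by rewrite -[leRHS]mule1 lee_wpmul2l.
Qed.

Lemma phat_ge0 j : (S `\ i) j -> (0 <= phat S lam i j r)%E.
Proof.
move=> [Sj /eqP ji]; apply: integral_ge0 => y /=; rewrite in_itv/= andbT => y0.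
rewrite mule_ge0 ?expeR_ge0//; apply: integral_ge0 => u _.
by rewrite lee_fin; have [+ _] := mlam Si Sj (contra_neq esym ji); apply.
Qed.

Lemma sum_phat_le (D : set nat) (b : R) : D `<=` S `\ i -> 0 <= b ->
  (forall y, 0 <= y -> \sum_(j \in D) mean_rate j y <= b * hazard y) ->
  (\sum_(j \in D) phat S lam i j r <= b%:E)%E.
Proof.
move=> DS b0 Db; have finD : finite_set D by exact: sub_finite_set DS finSi.
under eq_fsbigr.
  move=> j /set_mem/DS/mem_set jS; rewrite phatE//; over.
rewrite -ge0_integral_fsum//; first last.
- by move=> j y _; rewrite lee_fin mulr_ge0// mean_rate_ge0.
- move=> j; apply/measurable_EFinP/measurable_funM => //.
  by apply: measurable_funTS; exact: mean_rate_measurable.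
under eq_integral do rewrite fsumEFin// -mulr_fsumr.
apply: integral_surv_le => // y y0; rewrite Db// andbT.
by rewrite fsbig_finite//= sumr_ge0// => j _; exact: mean_rate_ge0.
Qed.

Lemma sum_phat_le1 : (\sum_(j \in S `\ i) phat S lam i j r <= 1)%E.
Proof. by apply: sum_phat_le => // y _; rewrite mul1r. Qed.

(** The contraction factor: the rate towards [0] is at least [d], that is, at
    least the fraction [d / M] of the hazard. *)
Lemma sum_phat_off0_le (d : R) : 0 <= d <= M -> S 0%N -> i != 0%N ->
  (forall y u, 0 <= y -> d <= lam i 0%N y u) ->
  (\sum_(j \in S `\ i `\ 0%N) phat S lam i j r <= (1 - d / M)%:E)%E.
Proof.
move=> /andP[d0 dM] S0 i0 lamd.
have Mgt0 : 0 < M by exact: lt_le_trans m0 (le_trans (hazard_ge 0) (hazard_le 0)).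
have S0i : (S `\ i) 0%N by split=> //; apply/eqP; rewrite eq_sym.
apply: sum_phat_le => [||y y0]; first exact: subDsetl.
  by rewrite subr_ge0 ler_pdivrMr// mul1r.
have rate0 : d <= mean_rate 0 y.
  rewrite -lee_fin -mean_rateE -[leLHS](int_prob_cst (clip y)).
  apply: ge0_le_integral_nonmeasurable => u _; first by rewrite lee_fin.
  by rewrite lee_fin /clipped_rate mem_set// lamd// clip_ge0.
have -> : \sum_(j \in S `\ i `\ 0%N) mean_rate j y = hazard y - mean_rate 0%N y.
  by rewrite /hazard [in RHS](fsbigD1 0%N)//= addrC addrK.
have : d / M * hazard y <= d.
  by rewrite -mulrA ler_piMr// mulrC ler_pdivrMr// mul1r hazard_le.
by rewrite mulrBl mul1r; lra.
Qed.

Lemma phat_fin_num j : (S `\ i) j -> phat S lam i j r \is a fin_num.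
Proof.
move=> Sj; rewrite ge0_fin_numE ?phat_ge0//.
apply: (le_lt_trans _ (ltry 1)); apply: le_trans sum_phat_le1.
rewrite (fsbigD1 j)//= leeDl// fsume_ge0// => k [Sk _]; exact: phat_ge0.
Qed.

Lemma taubar_ge0 : (0 <= taubar S lam i r)%E.
Proof. by apply: integral_ge0 => y _; exact: expeR_ge0. Qed.

Lemma taubar_le : (taubar S lam i r <= (m^-1)%:E)%E.
Proof.
rewrite /taubar; under eq_integral do rewrite survivalE -[surv _]mulr1.
apply: (@integral_surv_le (fun=> 1)); first by rewrite invr_ge0 ltW.
by move=> y y0; rewrite ler01/= mulrC ler_pdivlMr// mul1r hazard_ge.
Qed.

Lemma taubar_fin_num : taubar S lam i r \is a fin_num.
Proof.
by rewrite ge0_fin_numE ?taubar_ge0//; exact: le_lt_trans taubar_le (ltry _).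
Qed.

Hypothesis c_ge0 : forall y u, 0 <= y -> 0 <= c i y u.

Lemma phi_ge0 : (0 <= phi S lam c i r)%E.
Proof.
apply: integral_ge0 => y /=; rewrite in_itv/= andbT => y0.
rewrite mule_ge0 ?expeR_ge0//.
by apply: integral_ge0 => u _; rewrite lee_fin c_ge0.
Qed.

Lemma phi_le (C : R) : (forall y u, 0 <= y -> c i y u <= C) ->
  (phi S lam c i r <= C%:E * taubar S lam i r)%E.
Proof.
move=> cC; have C0 : 0 <= C.
  exact: le_trans (c_ge0 point (lexx _)) (cC _ _ (lexx _)).
rewrite /taubar -ge0_integralZl_EFin//; last 2 first.
- by move=> y _; rewrite survivalE lee_fin.
- rewrite (_ : survival S lam i r = EFin \o surv).
    exact/measurable_EFinP.
  by apply/funext => y; exact: survivalE.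
have int_c_ge0 y : 0 <= y -> (0 <= \int[r y]_u (c i y u)%:E)%E.
  by move=> y0; apply: integral_ge0 => u _; rewrite lee_fin c_ge0.
apply: ge0_le_integral_nonmeasurable => y /=; rewrite in_itv/= andbT => y0.
  by rewrite survivalE mule_ge0 ?lee_fin ?int_c_ge0.
rewrite muleC survivalE lee_wpmul2r ?lee_fin//.
rewrite -[leRHS](int_prob_cst y).
apply: ge0_le_integral_nonmeasurable => u _; first by rewrite lee_fin c_ge0.
by rewrite lee_fin cC.
Qed.

Lemma phi_fin_num (C : R) : (forall y u, 0 <= y -> c i y u <= C) ->
  phi S lam c i r \is a fin_num.
Proof.
move=> cC; rewrite ge0_fin_numE ?phi_ge0//; apply: (le_lt_trans (phi_le cC)).
by rewrite -(fineK taubar_fin_num) -EFinM ltry.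
Qed.

End state_bounds.

(** * The optimality equation *)

Lemma policy_nonempty (R : realType) (U : pointedMetricType R) :
  exists r : R -> pprobability (borel U) R, policy r.
Proof. by exists (fun=> point); exact: measurable_cst. Qed.

Lemma bounded_finite_set (R : realType) (T : choiceType) (h : T -> R) (A : set T) :
  finite_set A -> [bounded h i | i in A].
Proof.
move=> finA; exists (\sum_(j \in A) `|h j|); split; first exact: num_real.
move=> x hx i /= Ai; apply: (le_trans _ (ltW hx)).
rewrite (fsbigD1 i)//= lerDl fsbig_finite//=; last exact: finite_setD.
by rewrite sumr_ge0.
Qed.

(** The sum over the jumps out of [i] that avoid [z], indexed independently of
    [i]. *)
Lemma sum_off_diagonal (R : realType) (T : choiceType) (S : set T) (z i : T)
    (b : T -> R) : finite_set S ->
  \sum_(j <- finmap.enum_fset (fset_set (S `\ z))) (if j \in S `\ i then b j else 0) =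
  \sum_(j \in S `\ i `\ z) b j.
Proof.
move=> finS; rewrite -fsbig_finite/=; last exact: finite_setD.
rewrite [RHS](_ : _ =
    \sum_(j \in S `\ i `\ z) (if j \in S `\ i then b j else 0)).
  apply/esym/fsbig_widen; first by move=> j [[Sj _] jz].
  move=> j [[Sj jz] nj] /=; rewrite memNset// => Sij.
  by apply: nj; split.
by apply: eq_fsbigr => j /set_mem[Sij _]; rewrite mem_set.
Qed.

Theorem theorem4p2 (R : realType) (U : pointedMetricType R) (S : set nat)
    (lam : nat -> nat -> R -> U -> R) (c : nat -> R -> U -> R) :
  compact [set: U] -> S 0%N ->
  rates_measurable S lam -> cost_nonneg S c ->
  A1 S lam -> A2 S lam -> A3 S lam -> A4 S c -> A5 S -> A6 S lam ->
  exists (h : nat -> R) (g : R),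
    [bounded h i | i in S] /\ optimality_equation S lam c h g.
Proof.
move=> _ S0 mlam c_ge0 [M1 ltM1] [m m0 ltm] _ [_ [C cost_le]] finS
  [[d d0 lamd] _].
(* Enlarging the bound on the exit rates ensures 0 <= 1 - d / M. *)
pose M := Num.max M1 d.
have exit_rate_le i : S i -> forall y u, 0 <= y -> (exit_rate S lam i y u <= M%:E)%E.
  move=> Si y u y0; apply: (@le_trans _ _ M1%:E); last by rewrite lee_fin le_max lexx.
  apply: (le_trans _ (ltW ltM1)); apply: ereal_sup_ubound.
  by exists i, y, u.
have exit_rate_ge i : S i -> forall y u, 0 <= y -> (m%:E <= exit_rate S lam i y u)%E.
  move=> Si y u y0; apply: (le_trans (ltW ltm)); apply: ereal_inf_lbound.
  by exists i, y, u.
have c_le i : S i -> forall y u, 0 <= y -> c i y u <= C.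
  move=> Si y u y0; rewrite -lee_fin; apply: le_trans cost_le.
  by apply: ereal_sup_ubound; exists i, y, u.
have C0 : 0 <= C := le_trans (c_ge0 _ _ point S0 (lexx _)) (c_le _ S0 _ _ (lexx _)).
have dM : 0 <= d <= M by rewrite ltW// le_max lexx orbT.
have M0 : 0 < M by rewrite lt_max d0 orbT.
pose P := {r : R -> pprobability (borel U) R | policy r}.
have [r0 pr0] := policy_nonempty U.
pose f i (p : P) := fine (phi S lam c i (sval p)).
pose t i (p : P) := fine (taubar S lam i (sval p)).
pose a i (p : P) j := fine (phat S lam i j (sval p)).
pose q i p j := if j \in S `\ i then a i p j else 0.
pose s : seq nat := finmap.enum_fset (fset_set (S `\ 0%N)).
have finS0 : finite_set (S `\ 0%N) by exact: finite_setD.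
have sP j : j \in s -> (S `\ 0%N) j by rewrite [j \in _]in_fset_set// inE.
have sS i : i \in 0%N :: s -> S i.
  by rewrite inE => /predU1P[->//|/sP[]].
have fE i p : S i -> phi S lam c i (sval p) = (f i p)%:E.
  move=> Si; rewrite fineK//.
  exact: (phi_fin_num finS mlam Si (svalP p) m0 (exit_rate_ge i Si)
    (exit_rate_le i Si) (fun y u => c_ge0 i y u Si) (c_le i Si)).
have tE i p : S i -> taubar S lam i (sval p) = (t i p)%:E.
  move=> Si; rewrite fineK//.
  exact: (taubar_fin_num finS mlam Si (svalP p) m0 (exit_rate_ge i Si)
    (exit_rate_le i Si)).
have aE i p j : S i -> (S `\ i) j -> phat S lam i j (sval p) = (a i p j)%:E.
  move=> Si Sj; rewrite fineK//.
  exact: (phat_fin_num finS mlam Si (svalP p) m0 (exit_rate_ge i Si)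
    (exit_rate_le i Si)).
have sum_aE i p (D : set nat) : S i -> D `<=` S `\ i ->
    (\sum_(j \in D) phat S lam i j (sval p) = (\sum_(j \in D) a i p j)%:E)%E.
  move=> Si DS; rewrite -fsumEFin; last first.
    by apply: sub_finite_set DS _; exact: finite_setD.
  by apply: eq_fsbigr => j /set_mem/DS jS; rewrite aE.
(* The jump to 0 is absent from the left-hand side, as h 0 = 0. *)
have sum_sE i p (h : nat -> R) : h 0%N = 0 ->
    \sum_(j <- s) q i p j * h j = \sum_(j \in S `\ i) a i p j * h j.
  move=> h0; rewrite -(@fsbig_widen _ _ _ _ (S `\ i `\ 0%N)) //; last first.
    by move=> j [Sj /not_andP[//|/contrapT ->]]; rewrite /= h0 mulr0.
  rewrite -sum_off_diagonal//; apply: eq_bigr => j _.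
  by rewrite /q; case: ifP => // _; rewrite mul0r.
have sum_qE i p : \sum_(j <- s) q i p j = \sum_(j \in S `\ i `\ 0%N) a i p j.
  exact: sum_off_diagonal.
have a_ge0 i p j : S i -> (S `\ i) j -> 0 <= a i p j.
  by move=> Si Sj; rewrite fine_ge0// (phat_ge0 _ mlam Si Sj).
have [] := @average_cost_equation_solvable R nat P 0%N s (exist _ r0 pr0) f t q
  C m^-1 (1 - d / M).
- by apply/negP => /sP[_]; exact.
- exact: C0.
- by rewrite subr_ge0 ler_pdivrMr// mul1r; case/andP: dM.
- by rewrite gtrBl divr_gt0.
- by move=> i p /sS Si; rewrite fine_ge0// phi_ge0// => y u; exact: c_ge0.
- move=> i p /sS Si; rewrite -lee_fin EFinM -fE// -tE//.
  exact: (phi_le finS mlam Si (svalP p) m0 (exit_rate_ge i Si)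
    (exit_rate_le i Si) (fun y u => c_ge0 i y u Si) (c_le i Si)).
- by move=> i p /sS Si; rewrite fine_ge0// taubar_ge0.
- move=> i p /sS Si; rewrite -lee_fin -tE//.
  exact: (taubar_le finS mlam Si (svalP p) m0 (exit_rate_ge i Si)
    (exit_rate_le i Si)).
- move=> i p j /sS Si; rewrite /q; case: ifPn => // /set_mem Sj.
  exact: (a_ge0 i p j Si Sj).
- move=> i p /sS Si; rewrite sum_qE -lee_fin -sum_aE//.
  apply: le_trans (sum_phat_le1 finS mlam Si (svalP p) m0 (exit_rate_ge i Si)
    (exit_rate_le i Si)).
  apply: lee_fsum_nneg_subset; [exact/finite_setD/finite_setD|exact: finite_setD| |].
    by move=> j /set_mem[Sj _]; exact/mem_set.
  by move=> j /andP[_ /set_mem Sj]; exact: (phat_ge0 _ mlam Si Sj).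
- move=> i p /sP[Si /eqP i0]; rewrite sum_qE -lee_fin -sum_aE//.
  apply: (sum_phat_off0_le finS mlam Si (svalP p) m0 (exit_rate_ge i Si)
    (exit_rate_le i Si) dM S0 i0) => y u y0.
  exact/ltW/lamd.
move=> h [g [h0 hE]]; exists h, g; split; first exact: bounded_finite_set.
move=> i Si.
have iS : i \in 0%N :: s.
  rewrite inE; case: eqVneq => //= i0.
  by rewrite [i \in _]in_fset_set// inE; split=> //; exact/eqP.
have optE p : (phi S lam c i (sval p) +
    \sum_(j \in S `\ i) (phat S lam i j (sval p) * (h j)%:E) -
    g%:E * taubar S lam i (sval p))%E = (opt_value s f t q g h i p)%:E.
  rewrite fE// tE// /opt_value sum_sE// -EFinM.
  rewrite (_ : (\sum_(j \in S `\ i) _ = (\sum_(j \in S `\ i) a i p j * h j)%:E)%E)//.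
  rewrite -fsumEFin; last exact: finite_setD.
  by apply: eq_fsbigr => j /set_mem Sj; rewrite aE.
rewrite hE//; congr ereal_inf; apply/seteqP; split.
- by move=> _ [p _ <-]; exists (sval p); [exact: (svalP p)|exact: optE].
- move=> _ [r pr <-]; exists (exist _ r pr) => //.
  exact/esym/(optE (exist _ r pr)).
Qed.
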